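(* There is an absolute constant $c>0$ such that for every $n\ge 2$ and every graph property $\mathcal{P}$ of graphs on $n$ vertices (viewed as a Boolean function $\mathcal{P}:\{0,1\}^{\binom{n}{2}}\to\{0,1\}$), (1) $\mathrm{D}(\mathcal{P})\le c\,\mathrm{bs}(\mathcal{P})^2$, and (2) $\mathrm{D}(\mathcal{P})\le c\,\deg(\mathcal{P})^2$.
   Context: A graph on vertex set $[n]$ is identified with its adjacency string $x\in\{0,1\}^{\binom n2}$, whose coordinates are indexed by unordered pairs $\{u,v\}$ of distinct vertices, $x_{\{u,v\}}=1$ iff $\{u,v\}$ is an edge. A graph property is a Boolean function on such strings that is invariant under permutations of the vertices (isomorphic graphs get the same value). For a Boolean function $f:\{0,1\}^N\to\{0,1\}$: $\mathrm{D}(f)$ is the minimum depth of a deterministic decision tree (each internal node queries one input bit) computing $f$. For $B\subseteq[N]$, $x^{\oplus B}$ is $x$ with the bits in $B$ flipped; $B$ is a sensitive block of $x$ if $f(x^{\oplus B})\ne f(x)$. $\mathrm{bs}(f,x)$ is the maximum number of pairwise disjoint sensitive blocks of $x$, and $\mathrm{bs}(f)=\max_x \mathrm{bs}(f,x)$. $\deg(f)$ is the degree of the unique multilinear real polynomial agreeing with $f$ on $\{0,1\}^N$. *)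

(* Defs.v *)
From HB Require Import structures.
From mathcomp Require Import all_boot all_order all_fingroup all_algebra.
From mathcomp Require Import boolp reals.
From mathcomp Require Import mpoly.

Set Implicit Arguments.
Unset Strict Implicit.
Unset Printing Implicit Defensive.

Import Order.TTheory GRing.Theory Num.Theory.
Local Open Scope ring_scope.

(* The input bits are indexed by an arbitrary finite type [I], so that a string
   of length N = #|I| may be indexed by the vertex pairs of a graph. *)
Notation bits I := {ffun I -> bool}.
Notation boolfun I := (bits I -> bool).

Section DecisionTree.
Variable I : finType.

Inductive dtree : Type :=
| Leaf of bool
| Query of I & dtree & dtree.

Fixpoint dt_eval (t : dtree) (x : bits I) : bool :=
  match t with
  | Leaf b => b
  | Query i t0 t1 => if x i then dt_eval t1 x else dt_eval t0 x
  end.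

Fixpoint dt_depth (t : dtree) : nat :=
  match t with
  | Leaf _ => 0
  | Query _ t0 t1 => (maxn (dt_depth t0) (dt_depth t1)).+1
  end.

Definition dt_computes (t : dtree) (f : boolfun I) : Prop :=
  forall x, dt_eval t x = f x.

Definition dt_depth_ok (f : boolfun I) (d : nat) : bool :=
  `[< exists2 t, dt_computes t f & dt_depth t = d >].

Lemma dt_depth_ok_ex (f : boolfun I) : exists d, dt_depth_ok f d.
Proof.
suff [t tP] : exists t, dt_computes t f.
  by exists (dt_depth t); apply/asboolP; exists t.
have H (s : seq I) (z : bits I) : exists t, forall x,
    dt_eval t x = f [ffun i => if i \in s then x i else z i].
  elim: s z => [|i s IH] z.
    by exists (Leaf (f z)) => x /=; congr f; apply/ffunP => j; rewrite ffunE.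
  have [t0 t0P] := IH [ffun j => if j == i then false else z j].
  have [t1 t1P] := IH [ffun j => if j == i then true else z j].
  exists (Query i t0 t1) => x /=; case xi: (x i); rewrite (t0P, t1P);
    congr f; apply/ffunP => j; rewrite !ffunE in_cons;
    by case: eqVneq => [->|_] //=; rewrite xi; case: ifP.
have [t tP] := H (enum I) [ffun=> false].
exists t => x; rewrite tP; congr f; apply/ffunP => i.
by rewrite ffunE mem_enum.
Qed.

Definition dt_complexity (f : boolfun I) : nat := ex_minn (dt_depth_ok_ex f).

End DecisionTree.

Section BlockSensitivity.
Variable I : finType.

Definition flip (x : bits I) (B : {set I}) : bits I :=
  [ffun i => x i (+) (i \in B)].

Definition sensitive_block (f : boolfun I) (x : bits I) (B : {set I}) : bool :=
  f (flip x B) != f x.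

(* A sensitive block is nonempty, so a pairwise disjoint family of sensitive
   blocks has no repetition and may be taken to be a set of sets. *)
Definition bs_at (f : boolfun I) (x : bits I) : nat :=
  \max_(F : {set {set I}} | trivIset F && [forall B in F, sensitive_block f x B])
    #|F|.

Definition bs (f : boolfun I) : nat := \max_(x : bits I) bs_at f x.

End BlockSensitivity.

Section Degree.
Variables (R : realType) (I : finType).

(* The variable 'X_k stands for the input bit of index [enum_val k]. *)
Definition point (x : bits I) : 'I_#|I| -> R := fun k => (x (enum_val k))%:R.

Definition multilinear (p : {mpoly R[#|I|]}) : Prop :=
  forall m : 'X_{1..#|I|}, m \in msupp p -> forall k, (m k <= 1)%N.

Definition represents (p : {mpoly R[#|I|]}) (f : boolfun I) : Prop :=
  forall x : bits I, p.@[point x] = (f x)%:R.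

Lemma mlpoly_ex (f : boolfun I) : exists p, multilinear p /\ represents p f.
Proof.
pose F (x : bits I) (k : 'I_#|I|) : {mpoly R[#|I|]} :=
  if x (enum_val k) then 'X_k else 1 - 'X_k.
have FP x k m : m \in msupp (F x k) -> forall j, (m j <= (j == k))%N.
  rewrite /F; case: ifP => _; first by rewrite msuppX inE => /eqP-> j;
    rewrite mnm1E eq_sym.
  move/msuppB_le; rewrite mem_cat msupp1 msuppX !inE => /orP[]/eqP-> j.
    by rewrite mnm0E.
  by rewrite mnm1E eq_sym.
have prodP x (s : seq 'I_#|I|) m : uniq s -> m \in msupp (\prod_(k <- s) F x k) ->
    forall j, (m j <= (j \in s))%N.
  elim: s m => [|k s IH] m /=.
    by rewrite big_nil msupp1 inE => _ /eqP-> j; rewrite mnm0E.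
  case/andP=> ks us; rewrite big_cons => /msuppM_le/allpairsP[[m1 m2]] /=.
  case=> m1P m2P -> j; rewrite mnmDE in_cons.
  have := FP _ _ _ m1P j; have := IH _ us m2P j.
  case: eqVneq => [->|_] /=; first by rewrite (negPf ks) leqn0 => /eqP->; rewrite addn0.
  by move=> h; rewrite leqn0 => /eqP->.
have evalF x y : (\prod_k F x k).@[point y] = (x == y)%:R.
  rewrite rmorph_prod /=; case: eqVneq => [<-|xy].
    by apply: big1 => k _; rewrite /F; case: ifP => xk;
      rewrite ?mevalB ?meval1 mevalXU /point xk ?subr0.
  have [i xyi] : exists i, x i != y i.
    by apply/existsP; apply: contraNT xy => /existsPn h; apply/eqP/ffunP => i;
      apply/eqP; have := h i; rewrite negbK.
  rewrite (bigD1 (enum_rank i)) //= /F enum_rankK.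
  by case: ifP xyi => xi; case yi: (y i) => // _;
    rewrite ?mevalB ?meval1 mevalXU /point enum_rankK yi ?subrr mul0r.
exists (\sum_(x | f x) \prod_k F x k); split.
  move=> m /msupp_sum_le/flattenP[_ /mapP[x _ ->]] mP j.
  by apply: leq_trans (prodP _ _ _ (index_enum_uniq _) mP j) _; case: (_ \in _).
move=> y; rewrite raddf_sum /= (eq_bigr (fun x => (x == y)%:R)) //.
have [fy|fy] := boolP (f y).
  by rewrite (bigD1 y) //= eqxx big1 ?addr0 // => x /andP[_ /negPf->].
by apply: big1 => x fx; case: eqVneq fx fy => // -> ->.
Qed.

Lemma mlpoly_uniq (f : boolfun I) p q :
  multilinear p -> represents p f -> multilinear q -> represents q f -> p = q.
Proof.
move=> pm pf qm qf; apply/eqP; rewrite -subr_eq0; apply/negP => /negP r0.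
set r := p - q in r0.
have rm : multilinear r.
  by move=> m /msuppB_le; rewrite mem_cat => /orP[/pm|/qm].
have rx x : r.@[point x] = 0 by rewrite mevalB pf qf subrr.
have [m mr mmin] : exists2 m, m \in msupp r &
    forall m', m' \in msupp r -> (mdeg m <= mdeg m')%N.
  have ex : exists d, d \in [seq mdeg m | m <- msupp r].
    by exists (mdeg (mlead r)); apply: map_f; apply: mlead_supp.
  case: (ex_minnP ex) => _ /mapP[m mr ->] mmin; exists m => // m' m'r.
  by apply: mmin; apply: map_f.
have := rx [ffun i => m (enum_rank i) == 1%N]; rewrite mevalE.
rewrite (bigD1_seq m) //= [X in _ + X]big_seq_cond [X in _ + X]big1 => [|m' /andP[m'r m'm]].
  rewrite big1 ?mulr1 ?addr0 => [|k _].
    by apply/eqP; rewrite -mcoeff_msupp.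
  rewrite /point ffunE enum_valK; have := rm _ mr k.
  by case: (m k) => [|[|]].
have [k mk] : exists k, (m k < m' k)%N.
  apply/existsP; apply: contraNT m'm => /existsPn h.
  have le k : (m' k <= m k)%N by rewrite leqNgt.
  apply/eqP/mnmP => k; apply/eqP; rewrite eqn_leq le /=.
  rewrite leqNgt; apply/negP => lt; have := mmin _ m'r.
  rewrite leqNgt => /negP; apply; rewrite !mdegE.
  by rewrite (bigD1 k) //= [ltnRHS](bigD1 k) //= -addSn leq_add ?leq_sum.
rewrite (bigD1 k) //= /point ffunE enum_valK.
have := rm _ m'r k; case: (m k) mk => [|?]; case: (m' k) => [|[|]] //= _ _.
by rewrite mul0r mulr0.
Qed.

Definition mlpoly (f : boolfun I) : {mpoly R[#|I|]} := sval (cid (mlpoly_ex f)).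

(* [msize] is one more than the total degree, and is 0 on the zero polynomial;
   constant functions, including the constant false one, have degree 0. *)
Definition deg (f : boolfun I) : nat := (msize (mlpoly f)).-1.

End Degree.

Section GraphProperty.
Variable n : nat.

Definition vpair : finType := {e : {set 'I_n} | #|e| == 2}.

Lemma vpair_perm_subproof (s : {perm 'I_n}) (e : vpair) : #|s @: val e| == 2.
Proof. by rewrite card_imset ?(valP e) //; apply: perm_inj. Qed.

Definition vpair_perm (s : {perm 'I_n}) (e : vpair) : vpair :=
  Sub (s @: val e) (vpair_perm_subproof s e).

Definition graph_perm (s : {perm 'I_n}) (x : bits vpair) : bits vpair :=
  [ffun e => x (vpair_perm s e)].

Definition graph_property (P : boolfun vpair) : Prop :=
  forall (s : {perm 'I_n}) (x : bits vpair), P (graph_perm s x) = P x.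

End GraphProperty.

(* Main.v *)
(* As D(P) <= n(n-1)/2, it suffices to bound bs(P) and deg(P) below by a constant
   times n when P is not constant. Let x have the fewest edges, say m, among the
   graphs on which P differs from its value on the empty graph. Restricted to the
   subgraphs of x, P is an AND of m variables up to negation, so bs(P) and deg(P)
   are at least of order m. If m < n/4, then x has more than n/2 isolated vertices.
   Pick a non-isolated vertex v, delete its edges, and join a set A of vertices,
   taken among v and the isolated vertices, to all former neighbours of v.
   Isomorphism invariance makes P a function of #|A| alone, and its values at
   A = set0 and at A = [set v] differ. Hence bs(P) is at least the number of
   candidates for A, and the corresponding univariate polynomial, of degree at most
   deg(P), takes one of the values 0, 1 on at least half of an initial segment of
   the integers without being constant. *)
Require Import Defs.
From mathcomp Require Import all_boot all_order all_fingroup all_algebra.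
From mathcomp Require Import boolp reals.
From mathcomp Require Import mpoly zify.

Import Order.TTheory GRing.Theory Num.Theory.
Local Open Scope ring_scope.

(** * Decision tree depth from above, block sensitivity from below *)

Lemma dt_complexity_le (I : finType) (f : boolfun I) (t : dtree I) :
  dt_computes t f -> (dt_complexity f <= dt_depth t)%N.
Proof.
move=> tf; rewrite /dt_complexity; case: ex_minnP => d _; apply.
by apply/asboolP; exists t.
Qed.

Lemma dt_complexity_le_card (I : finType) (f : boolfun I) :
  (dt_complexity f <= #|I|)%N.
Proof.
(* Induction on the list [s] of bits still to be queried, with the answers received so far stored in
   [z]. *)
have H (s : seq I) (z : bits I) : exists2 t, (dt_depth t <= size s)%N & forall x,
    dt_eval t x = f [ffun i => if i \in s then x i else z i].
  elim: s z => [|i s IH] z.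
    by exists (Leaf I (f z)) => // x /=; congr f; apply/ffunP => j; rewrite ffunE.
  have [t0 d0 t0P] := IH [ffun j => if j == i then false else z j].
  have [t1 d1 t1P] := IH [ffun j => if j == i then true else z j].
  exists (Query i t0 t1) => [|x] /=; first by rewrite ltnS geq_max d0.
  case xi: (x i); rewrite (t0P, t1P);
    congr f; apply/ffunP => j; rewrite !ffunE in_cons;
    by case: eqVneq => [->|_] //=; rewrite xi; case: ifP.
have [t dt tP] := H (enum I) [ffun=> false].
rewrite cardE (leq_trans _ dt) // dt_complexity_le // => x.
by rewrite tP; congr f; apply/ffunP => i; rewrite ffunE mem_enum.
Qed.

(** Sensitive blocks are nonempty, so disjoint ones are distinct and the indexed family has as many
    members as indices. *)
Lemma bs_ge_card (I K : finType) (f : boolfun I) (x : bits I) (J : {set K})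
    (B : K -> {set I}) :
  {in J &, forall u w, u != w -> [disjoint B u & B w]} ->
  {in J, forall u, sensitive_block f x (B u)} ->
  (#|J| <= bs f)%N.
Proof.
move=> dB sB.
have B0 u : u \in J -> B u != set0.
  move=> /sB; apply: contraTneq => ->; rewrite /sensitive_block negbK.
  by apply/eqP; congr f; apply/ffunP => i; rewrite ffunE inE addbF.
have injB : {in J &, injective B}.
  move=> u w uJ wJ eB; apply/eqP; apply: contraTT (B0 u uJ) => uw.
  by have := dB u w uJ wJ uw; rewrite -eB -setI_eq0 setIid negbK.
rewrite -(card_in_imset injB) /bs.
apply: leq_trans (leq_bigmax x); rewrite /bs_at; apply: leq_bigmax_cond.
apply/andP; split; last by apply/'forall_implyP => _ /imsetP[u uJ ->]; apply: sB.
apply/trivIsetP => _ _ /imsetP[u uJ ->] /imsetP[w wJ ->] nB.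
by apply: dB => //; apply: contraNneq nB => ->.
Qed.

(* Each input bit is identified with a variable [inl u] or fixed to [inr b]; the
   variables are then set to the indicator function of [A]. *)
Definition subst {I K : finType} (s : I -> K + bool) (A : {set K}) : bits I :=
  [ffun i => match s i with inl u => u \in A | inr b => b end].

(** The input bits identified with the variable [u] form a block; flipping it turns [subst s set0]
    into [subst s [set u]]. *)
Lemma subst_bs_ge {I K : finType} (f : boolfun I) (s : I -> K + bool) (J : {set K}) :
  {in J, forall u, f (subst s [set u]) != f (subst s set0)} ->
  (#|J| <= bs f)%N.
Proof.
move=> sens; apply: (@bs_ge_card _ _ f (subst s set0) J
          (fun u => [set i | s i == inl u])).
  move=> u w _ _ uw; rewrite -setI_eq0; apply/eqP/setP => i; rewrite !inE.
  by apply/negbTE; apply: contra uw => /andP[/eqP-> /eqP[->]].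
move=> u /sens; rewrite /sensitive_block; congr (f _ != _).
apply/ffunP => i; rewrite !ffunE inE.
by case: (s i) => [w|[]] //; rewrite !inE eqE.
Qed.


(** * Symmetric set functions and univariate polynomials *)

(** Newton interpolation: the system is triangular with unit diagonal, so each new coefficient
    corrects the value at [k.+1] without disturbing earlier ones. *)
Lemma binomial_expansion (V : zmodType) (h : nat -> V) (k : nat) :
  exists alpha : nat -> V,
    forall t, (t <= k)%N -> h t = \sum_(i < k.+1) alpha i *+ 'C(t, i).
Proof.
elim: k => [|k [alpha IH]].
  by exists (fun=> h 0) => t; rewrite leqn0 => /eqP->; rewrite big_ord1.
pose beta i := if i == k.+1 then h k.+1 - \sum_(j < k.+1) alpha j *+ 'C(k.+1, j)
               else alpha i.
exists beta => t; have eqb : \sum_(i < k.+1) beta i *+ 'C(t, i) =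
    \sum_(i < k.+1) alpha i *+ 'C(t, i).
  by apply: eq_bigr => i _; rewrite /beta ltn_eqF.
rewrite big_ord_recr /= eqb leq_eqVlt => /predU1P[->|tk].
  by rewrite binn mulr1n /beta eqxx addrC subrK.
by rewrite bin_small // mulr0n addr0; apply: IH.
Qed.

Lemma sum_subsets_by_card {V : zmodType} {K : finType} (A : {set K})
    (alpha : nat -> V) (k : nat) : (#|A| <= k)%N ->
  \sum_(T : {set K} | T \subset A) alpha #|T| =
  \sum_(i < k.+1) alpha i *+ 'C(#|A|, i).
Proof.
move=> Ak; rewrite (partition_big (fun T : {set K} => inord #|T| : 'I_k.+1) xpredT) //=.
apply: eq_bigr => i _; rewrite -cards_draws -sumr_const.
have cT (T : {set K}) : T \subset A -> (#|T| < k.+1)%N.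
  by move=> /subset_leq_card TA; rewrite ltnS (leq_trans TA).
apply: eq_big => [T|T /andP[TA /eqP <-]]; last by rewrite inordK ?cT.
rewrite inE; case TA: (T \subset A) => //=.
by rewrite -val_eqE /= inordK ?cT.
Qed.

(** Uniqueness in Moebius inversion: by induction on cardinality the terms of proper subsets
    cancel. *)
Lemma subset_sums_inj {V : zmodType} {K : finType} (J : {set K}) (a b : {set K} -> V) :
  (forall A : {set K}, A \subset J ->
     \sum_(T : {set K} | T \subset A) a T = \sum_(T : {set K} | T \subset A) b T) ->
  forall A : {set K}, A \subset J -> a A = b A.
Proof.
move=> eqs A; move: {-1}#|A| (leqnn #|A|) => k.
elim: k A => [|k IH] A Ak AJ.
  have := eqs A AJ; move: Ak; rewrite leqn0 cards_eq0 => /eqP->.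
  have subs0 : (fun T : {set K} => T \subset set0) =1 pred1 set0.
    by move=> T; rewrite subset0.
  by rewrite !(eq_bigl _ _ subs0) !big_pred1_eq.
have := eqs A AJ; rewrite (bigD1 A) //= [RHS](bigD1 A) //=.
rewrite (eq_bigr b); first by move=> /addIr.
move=> T; rewrite andbC -properEneq => TA; apply: IH.
  by rewrite -ltnS (leq_trans (proper_card TA)).
by apply: subset_trans AJ; apply: proper_sub.
Qed.

Definition binomial_poly (R : fieldType) (i : nat) : {poly R} :=
  i`!%:R^-1 *: \prod_(0 <= j < i) ('X - (j%:R)%:P).

Lemma size_binomial_poly (R : fieldType) i : (size (binomial_poly R i) <= i.+1)%N.
Proof.
by rewrite (leq_trans (size_scale_leq _ _)) // size_prod_XsubC size_iota subn0.
Qed.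

Lemma horner_binomial_poly (R : numFieldType) i t :
  (binomial_poly R i).[t%:R] = 'C(t, i)%:R.
Proof.
have ffact : (\prod_(0 <= j < i) ('X - (j%:R)%:P)).[t%:R] = (t ^_ i)%:R :> R.
  elim: i => [|i IH]; first by rewrite big_geq // hornerC.
  rewrite big_nat_recr //= hornerM IH ffactnSr natrM hornerXsubC.
  (* For [t < i] the truncated [t - i] is not the ring difference, but the falling factorial is
     already 0. *)
  have [it|ti] := leqP i t; first by rewrite natrB.
  by rewrite ffact_small // !mul0r.
rewrite hornerZ ffact -bin_ffact natrM mulrC mulfK //.
by rewrite pnatr_eq0 -lt0n fact_gt0.
Qed.

(* The Moebius coefficients [a T] of a symmetric function depend on [#|T|] only. *)
Lemma symmetric_low_degree_poly {R : numFieldType} {K : finType} (J : {set K})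
    (a : {set K} -> R) (h : nat -> R) (d : nat) :
  (forall A : {set K}, A \subset J ->
     h #|A| = \sum_(T : {set K} | T \subset A) a T) ->
  (forall T : {set K}, (d < #|T|)%N -> a T = 0) ->
  exists2 g : {poly R}, (size g <= d.+1)%N &
    forall t, (t <= #|J|)%N -> g.[t%:R] = h t.
Proof.
move=> ha ad; have [alpha alphaP] := binomial_expansion _ h #|J|.
have aE : forall T : {set K}, T \subset J -> a T = alpha #|T|.
  apply: subset_sums_inj => A AJ; have cA := subset_leq_card AJ.
  by rewrite -ha // (sum_subsets_by_card _ _ _ cA) alphaP.
(* Some subset of [J] has size [i], and its coefficient [a T] is both [alpha i] and 0. *)
have alpha0 i : (i <= #|J|)%N -> (d < i)%N -> alpha i = 0.
  move=> iJ di; have : (0 < #|[set T : {set K} | T \subset J & #|T| == i]|)%N.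
    by rewrite cards_draws bin_gt0.
  case/card_gt0P=> T; rewrite inE => /andP[TJ /eqP Ti].
  by rewrite -Ti -aE // ad // Ti.
exists (\sum_(i < #|J|.+1 | (i <= d)%N) alpha i *: binomial_poly R i).
  apply: (leq_trans (size_sum _ _ _)); apply/bigmax_leqP => i id.
  apply: leq_trans (size_scale_leq _ _) _.
  by apply: leq_trans (size_binomial_poly _ _) _.
move=> t tJ; rewrite horner_sum alphaP // big_mkcond; apply: eq_bigr => i _ /=.
case: leqP => [_|di]; first by rewrite hornerZ horner_binomial_poly mulr_natr.
by rewrite alpha0 ?mul0rn // -ltnS.
Qed.

(** Since [g] is not constant, each of the values 0 and 1 is taken at most [(size g).-1] times among
    the [k.+1] points. *)
Lemma boolean_valued_poly_size (R : numFieldType) (g : {poly R}) (h : nat -> bool)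
    (k : nat) :
  (forall t, (t <= k)%N -> g.[t%:R] = (h t)%:R) ->
  (exists2 t, (t <= k)%N & h t != h 0) ->
  (k < (size g).-1.*2)%N.
Proof.
move=> gh [t1 t1k ht1].
have nr (b : bool) : (size [seq t <- iota 0 k.+1 | h t == b] <= (size g).-1)%N.
  pose rs := [seq t%:R : R | t <- [seq t <- iota 0 k.+1 | h t == b]].
  have [t0 t0k ht0] : exists2 t, (t <= k)%N & h t != b.
    by case: (eqVneq (h 0) b) ht1 => [->|]; [exists t1|exists 0].
  have gb0 : g - (b%:R)%:P != 0.
    apply: contraNneq ht0 => gb; have : (g - (b%:R)%:P).[t0%:R] = 0.
      by rewrite gb horner0.
    by rewrite !hornerE gh // => /eqP; rewrite subr_eq0 eqr_nat;
      case: (h t0); case: (b).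
  have : (size rs < size (g - (b%:R)%:P)%R)%N.
    apply: max_poly_roots gb0 _ _.
      apply/allP => _ /mapP[t tP ->]; move: tP; rewrite mem_filter mem_iota /= add0n ltnS.
      by move=> /andP[/eqP <- tk]; rewrite rootE !hornerE gh ?subrr.
    rewrite map_inj_uniq ?filter_uniq ?iota_uniq //.
    by move=> u w /eqP; rewrite eqr_nat => /eqP.
  rewrite size_map => sz; rewrite -ltnS; apply: leq_trans sz _.
  apply: leq_trans (size_polyD _ _) _; rewrite size_polyN geq_max leqSpred.
  by apply: leq_trans (size_polyC_leq1 _) _.
have := leq_add (nr true) (nr false); rewrite addnn !size_filter.
have -> : count (fun t => h t == false) (iota 0 k.+1) =
          count (predC (fun t => h t == true)) (iota 0 k.+1).
  by apply: eq_count => t /=; case: (h t).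
by rewrite count_predC size_iota.
Qed.


(** * Degree under substitution *)

(** Substitution does not raise the degree, and symmetry turns the result into a nonconstant
    univariate polynomial in [#|A|] with Boolean values at [0, ..., #|J|]. *)
Lemma subst_deg_ge (R : realType) (I K : finType) (f : boolfun I)
    (s : I -> K + bool) (J : {set K}) :
  (forall A B : {set K}, A \subset J -> B \subset J -> #|A| = #|B| ->
     f (subst s A) = f (subst s B)) ->
  (exists2 A : {set K}, A \subset J & f (subst s A) != f (subst s set0)) ->
  (#|J| < (deg R f).*2)%N.
Proof.
move=> sym [A1 A1J fA1].
have rep : represents (mlpoly R f) f by rewrite /mlpoly; case: cid => p [].
pose p := mlpoly R f; pose d := (msize p).-1.
(* The default [set0] is reached only for [t] above [#|J|]. *)
pose h t := f (subst s (odflt set0 [pick A : {set K} | (A \subset J) && (#|A| == t)])).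
have hE (A : {set K}) : A \subset J -> h #|A| = f (subst s A).
  move=> AJ; rewrite /h; case: pickP => [B /andP[BJ /eqP BA]|/(_ A)].
    exact: sym.
  by rewrite AJ eqxx.
pose src (k : 'I_#|I|) := s (enum_val k).
(* On Boolean inputs the monomial [m] becomes the product of the variables in [vars m], or 0 if some
   factor is fixed to false; [a T] collects the coefficients landing on [T]. *)
pose vars (m : 'X_{1.. #|I|}) : {set K} :=
  \bigcup_(k | (0 < m k)%N) [set u | src k == inl u].
pose alive (m : 'X_{1.. #|I|}) := [forall k, (0 < m k)%N ==> (src k != inr false)].
pose a (T : {set K}) := \sum_(m <- msupp p | alive m && (vars m == T)) p@_m.
have monE (A : {set K}) (m : 'X_{1.. #|I|}) :
    \prod_k point R (subst s A) k ^+ m k = (alive m && (vars m \subset A))%:R :> R.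
  have [/andP[/forallP al /bigcupsP vA]|] := boolP (_ && _).
    apply: big1 => k _; case mk: (m k) => [|j]; first by rewrite expr0.
    rewrite /point ffunE -/(src k); have := implyP (al k); have := vA k; rewrite mk.
    case: (src k) => [u /(_ isT) uA _|[]]; rewrite ?expr1n //; last by move=> _ /(_ isT).
    by move/subsetP: uA => ->; rewrite ?inE ?expr1n.
  rewrite negb_and => al.
  have [k mk k0] : exists2 k, (0 < m k)%N & subst s A (enum_val k) = false.
    case/orP: al => [/forallPn[k]|/subsetPn[u /bigcupP[k mk]]].
      by rewrite negb_imply negbK => /andP[mk /eqP sk]; exists k => //;
        rewrite ffunE -/(src k) sk.
    by rewrite inE => /eqP sk /negbTE uA; exists k; rewrite // ffunE -/(src k) sk.
  by rewrite (bigD1 k) //= /point k0 expr0n (gtn_eqF mk) mul0r.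
have [|T dT|g sg gh] := @symmetric_low_degree_poly R K J a (fun t => (h t)%:R) d.
- move=> A AJ; rewrite hE // -rep mevalE -/p.
  under eq_bigr do rewrite monE.
  rewrite /a (exchange_big_dep xpredT) //=; apply: eq_bigr => m _.
  have [al|al] := boolP (alive m); last by rewrite mulr0 big1 // => T; rewrite andbF.
  rewrite /=; have [vA|vA] := boolP (vars m \subset A).
    rewrite mulr1 (eq_bigl (pred1 (vars m))) ?big_pred1_eq // => T.
    by rewrite /= eq_sym; case: eqVneq => [->|_]; rewrite ?vA ?andbF.
  rewrite mulr0 big1 // => T /andP[TA /eqP vT].
  by rewrite vT TA in vA.
- rewrite /a big_seq_cond big_pred0 // => m; apply/negbTE.
  apply: contraL dT => /and3P[mp _ /eqP <-]; rewrite -leqNgt.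
  have : (mdeg m <= d)%N by rewrite -ltnS prednK ?msize_mdeg_lt // (leq_ltn_trans _ (msize_mdeg_lt mp)).
  (* Each [k] with [m k] positive contributes at most one variable to [vars m]. *)
  apply: leq_trans; rewrite /vars mdegE.
  rewrite big_mkcond /=; elim/big_rec2: _ => [|k c X _ Xc]; first by rewrite cards0.
  apply: leq_trans (leq_card_setU _ _) (leq_add _ Xc).
  case: ifP => [mk|_]; last by rewrite cards0.
  apply: leq_trans mk; case: (src k) => [u|b].
    by rewrite -(cards1 u) subset_leq_card //; apply/subsetP => w; rewrite !inE eq_sym.
  by apply: (@leq_trans 0) => //; rewrite leqn0 cards_eq0; apply/eqP/setP => w; rewrite !inE.
have := boolean_valued_poly_size R g h #|J|.
have h0 : h 0 = f (subst s set0) by rewrite -hE ?sub0set ?cards0.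
move=> /(_ gh) lt; apply: leq_trans (lt _) _.
  by exists #|A1|; rewrite ?subset_leq_card // hE // h0.
by rewrite leq_double /deg -/p -/d -subn1 leq_subLR.
Qed.

(** * Vertex permutations and reattached neighbourhoods *)

(** A transposition trades an element of [A :\: B] for one of [B :\: A], which shrinks the
    difference; both lie in [J]. *)
Lemma perm_on_transitive {T : finType} (J A B : {set T}) :
  A \subset J -> B \subset J -> #|A| = #|B| ->
  exists2 s : {perm T}, perm_on J s & s @: A = B.
Proof.
move: {-1}#|A :\: B| (erefl #|A :\: B|) => k.
elim: k A => [|k IH] A Ak AJ BJ AB.
  exists 1%g; first exact: perm_on1.
  rewrite (eq_imset _ (perm1 (T:=T))) imset_id; apply/eqP.
  by rewrite eqEcard AB leqnn andbT -setD_eq0 -cards_eq0 Ak.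
have [a] : exists a, a \in A :\: B by apply/card_gt0P; rewrite Ak.
rewrite inE => /andP[aB aA].
have [b] : exists b, b \in B :\: A.
  by apply/card_gt0P; have := cardsID B A; have := cardsID A B; rewrite setIC AB Ak; lia.
rewrite inE => /andP[bA bB].
pose t := tperm a b.
have tA : t @: A = b |: A :\ a.
  apply/setP => x; rewrite !inE; apply/imsetP/idP => [[y yA ->]|].
    rewrite /t; case: tpermP => [_|yb|/eqP ya /eqP yb]; rewrite ?eqxx //.
      by rewrite -yb yA in bA.
    by rewrite ya yA orbT.
  case/predU1P => [->|/andP[xa xA]]; first by exists a; rewrite ?tpermL.
  by exists x; rewrite ?tpermD // eq_sym //; apply: contraNneq bA => <-.
have aJ := subsetP AJ a aA; have bJ := subsetP BJ b bB.
have tJ : perm_on J t.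
  apply/subsetP => x; rewrite inE /t; case: tpermP => [->|->|_ _] //.
  by rewrite eqxx.
have [|||s sJ sB] := IH (t @: A) _ _ BJ.
- have -> : t @: A :\: B = (A :\: B) :\ a.
    by apply/setP => x; rewrite tA !inE; case: eqVneq => [->|_]; rewrite ?bB ?andbF //= andbCA.
  by apply/eqP; have := cardsD1 a (A :\: B); rewrite inE aA aB Ak; lia.
- by rewrite -(im_perm_on tJ) imsetS.
- by rewrite card_imset //; apply: perm_inj.
exists (t * s)%g; first exact: perm_onM.
by rewrite -sB -imset_comp; apply: eq_imset => x; rewrite /= permM.
Qed.

(* Deletes the edges of [x] meeting [J] and joins every vertex of [A] to every
   vertex of [W]; this reading needs [A] and [W] to be disjoint. *)
Definition attach {n} (x : bits (vpair n)) (J W A : {set 'I_n}) : bits (vpair n) :=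
  [ffun e => x e && [disjoint val e & J]
             || ~~ [disjoint val e & A] && ~~ [disjoint val e & W]].

Lemma perm_on_imset_disjoint {T : finType} {J A : {set T}} {s : {perm T}} :
  perm_on J s -> [disjoint A & J] -> s @: A = A.
Proof.
move=> sJ dA; rewrite -[RHS]imset_id; apply: eq_in_imset => u uA.
by apply: out_perm sJ _; rewrite (disjointFr dA uA).
Qed.

(** Such an [s] fixes every vertex of [W] and every pair disjoint from [J], so only the set of
    attached vertices moves. *)
Lemma graph_perm_attach n (x : bits (vpair n)) (J W A : {set 'I_n}) (s : {perm 'I_n}) :
  [disjoint W & J] -> perm_on J s ->
  graph_perm s (attach x J W (s @: A)) = attach x J W A.
Proof.
move=> WJ sJ; apply/ffunP => e; rewrite !ffunE /=.
have dis (B : {set 'I_n}) : [disjoint s @: val e & s @: B] = [disjoint val e & B].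
  by apply: imset_disjoint; apply: perm_inj.
rewrite -{1}(im_perm_on sJ) -{1}(perm_on_imset_disjoint sJ WJ) !dis.
case eJ: [disjoint val e & J]; last by rewrite !andbF.
congr (x _ && _ || _); apply: val_inj => /=.
exact: perm_on_imset_disjoint sJ eJ.
Qed.

(** A pair meeting [W] has at most one vertex in [J], and that vertex is its variable; all other
    pairs do not depend on [A]. *)
Lemma attach_subst n (x : bits (vpair n)) (J W : {set 'I_n}) :
  [disjoint W & J] ->
  exists s, forall A : {set 'I_n}, A \subset J -> attach x J W A = subst s A.
Proof.
move=> WJ.
exists (fun e : vpair n => if [disjoint val e & W] then inr (x e && [disjoint val e & J]) else
  if [pick u in J | u \in val e] is Some u then inl u else inr (x e)) => A AJ.
apply/ffunP => e; rewrite !ffunE.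
case: (boolP [disjoint val e & W]) => [_|]; first by rewrite andbF orbF.
rewrite andbT -setI_eq0 => /set0Pn[w]; rewrite inE => /andP[we wW].
case: pickP => [u /andP[uJ ue]|eJ]; last first.
  have dJ : [disjoint val e & J].
    by rewrite disjoint_subset; apply/subsetP => u ue; have := eJ u; rewrite !inE ue andbT => ->.
  by rewrite dJ (disjointWr AJ dJ) andbT orbF.
(* Otherwise [u], [u'] and a vertex [w] of [W] would be three elements of a pair. *)
have uniq_u u' : u' \in val e -> u' \in J -> u' = u.
  move=> u'e u'J; apply/eqP; have := eqP (valP e); apply: contra_eqT => u'u.
  have wu : u != w by apply: contraTneq uJ => ->; rewrite (disjointFr WJ wW).
  have wu' : u' != w by apply: contraTneq u'J => ->; rewrite (disjointFr WJ wW).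
  rewrite gtn_eqF // (@leq_trans #|[set u'; u; w]|) //.
    by rewrite -setUA cardsU1 !inE negb_or u'u wu' cards2 wu.
  by apply/subset_leq_card/subsetP => v; rewrite !inE => /orP[/orP[]|] /eqP->.
have -> : [disjoint val e & J] = false.
  by apply/negbTE; rewrite -setI_eq0; apply/set0Pn; exists u; rewrite inE ue.
rewrite andbF /= -setI_eq0; apply/set0Pn/idP => [[v]|uA].
  by rewrite inE => /andP[ve vA]; rewrite -(uniq_u v ve (subsetP AJ v vA)).
by exists u; rewrite inE ue.
Qed.

Lemma disjointPn (T : finType) (A B : {set T}) :
  reflect (exists2 u, u \in A & u \in B) (~~ [disjoint A & B]).
Proof.
rewrite -setI_eq0; apply: (iffP (set0Pn _)) => [[u]|[u uA uB]].
  by rewrite inE => /andP[]; exists u.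
by exists u; rewrite inE uA.
Qed.

(** * Bounds from a graph with fewest edges *)

Definition edges {n} (x : bits (vpair n)) : {set vpair n} := [set e | x e].

Lemma card_cover_edges n (x : bits (vpair n)) :
  (#|\bigcup_(e in edges x) val e| <= (#|edges x|).*2)%N.
Proof.
rewrite -muln2 -sum_nat_const; apply: (big_rec2 (fun (X : {set 'I_n}) c => #|X| <= c)%N).
  by rewrite cards0.
move=> e X c _ Xc; apply: leq_trans (leq_card_setU _ _) (leq_add _ Xc).
by rewrite (eqP (valP e)).
Qed.

(** By minimality every proper subgraph of [x] has the value of the empty graph, so each edge is a
    sensitive block and [P] on subgraphs depends on the number of edges only. *)
Lemma edges_bounds (R : realType) n (P : boolfun (vpair n)) (x : bits (vpair n)) :
  P x != P [ffun=> false] ->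
  (forall y, (#|edges y| < #|edges x|)%N -> P y = P [ffun=> false]) ->
  (#|edges x| <= bs P)%N /\ (#|edges x| < (deg R P).*2)%N.
Proof.
move=> Px xmin; pose s e : vpair n + bool := if x e then inl e else inr false.
have edge_subst (A : {set vpair n}) : edges (subst s A) = edges x :&: A.
  by apply/setP => e; rewrite !inE ffunE /s; case: (x e); rewrite // inE.
have full : subst s (edges x) = x.
  by apply/ffunP => e; rewrite ffunE /s; case xe: (x e); rewrite // inE.
have proper (A : {set vpair n}) : A \subset edges x -> A != edges x -> P (subst s A) = P [ffun=> false].
  move=> Ax nA; apply: xmin; rewrite edge_subst (setIidPr Ax) proper_card //.
  by rewrite properEneq nA.
have none : P (subst s set0) = P [ffun=> false].
  by congr P; apply/ffunP => e; rewrite !ffunE /s; case: (x e); rewrite // inE.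
split.
  apply: (@bs_ge_card _ _ P x (edges x) (fun e => [set e])) => [e e' _ _|e].
    by rewrite disjoints1 inE.
  rewrite inE => xe; rewrite /sensitive_block xmin 1?eq_sym //.
  have -> : edges (flip x [set e]) = edges x :\ e.
    by apply/setP => e'; rewrite !inE ffunE inE; case: eqVneq => [->|_]; rewrite ?xe ?addbF.
  by rewrite [ltnRHS](cardsD1 e) inE xe.
apply: (@subst_deg_ge R _ _ P s) => [A B Ax Bx AB|].
  have [eA|nA] := eqVneq A (edges x).
    by congr (P (subst s _)); apply/eqP; rewrite eq_sym eqEcard eA Bx /= -AB eA leqnn.
  rewrite (proper A) ?(proper B) //; apply: contraNneq nA => eB.
  by rewrite eqEcard Ax AB eB leqnn.
by exists (edges x); rewrite // full none.
Qed.

Lemma isolated_bounds (R : realType) n (P : boolfun (vpair n)) (x : bits (vpair n)) :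
  graph_property P ->
  P x != P [ffun=> false] ->
  (forall y, (#|edges y| < #|edges x|)%N -> P y = P [ffun=> false]) ->
 
  (n <= #|edges x|.*2 + bs P)%N /\ (n <= #|edges x|.*2 + (deg R P).*2)%N.
Proof.
move=> Pinv Px xmin; pose V := \bigcup_(e in edges x) val e.
have [v [e0 xe0 ve0]] : exists v, exists2 e, x e & v \in val e.
  have [e xe] : exists e, x e.
    apply/existsP; apply: contraNT Px => /existsPn x0; apply/eqP; congr P.
    by apply/ffunP => e; rewrite ffunE; apply/negbTE.
  have /card_gt0P[v ve] : (0 < #|val e|)%N by rewrite (eqP (valP e)).
  by exists v, e.
have VE e u : x e -> u \in val e -> u \in V.
  by move=> xe ue; apply/bigcupP; exists e; rewrite ?inE.
(* [W] is the neighbourhood of [v]; since [V] is the set of non-isolated vertices, [J] is [v] with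
   the isolated ones. *)
pose W := [set w | (w != v) && [exists e : vpair n, [&& x e, v \in val e & w \in val e]]].
pose J := v |: ~: V.
have WJ : [disjoint W & J].
  rewrite disjoint_subset; apply/subsetP => w; rewrite !inE.
  case/andP=> wv /existsP[e /and3P[xe _ we]].
  by rewrite (negPf wv) negbK (VE e).
have [s sP] := attach_subst n x J W WJ.
have vJ : v \in J by rewrite !inE eqxx.
(* Attaching nothing loses at least the edge [e0], so minimality applies. *)
have x0 : P (attach x J W set0) = P [ffun=> false].
  have d0 (e : vpair n) : [disjoint val e & set0] by rewrite -setI_eq0 setI0.
  apply: xmin; apply/proper_card/properP; split.
    apply/subsetP => e; rewrite !inE ffunE.
    by rewrite d0 orbF => /andP[].
  exists e0; rewrite !inE // ffunE negb_or !negb_and !negbK.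
  apply/andP; split; last by rewrite d0.
  by apply/orP; right; apply/disjointPn; exists v.
(* Attaching [v] alone restores exactly its deleted edges. *)
have xv : attach x J W [set v] = x.
  apply/ffunP => e; rewrite ffunE.
  have [ve|ve] := boolP (v \in val e).
    have -> : [disjoint val e & J] = false by apply/negbTE/disjointPn; exists v.
    have -> : ~~ [disjoint val e & [set v]] by apply/disjointPn; exists v; rewrite ?inE.
    rewrite andbF /=; apply/disjointPn/idP => [[w we]|xe].
      rewrite inE => /andP[wv /existsP[e' /and3P[xe' ve' we']]].
      have pairE (f : vpair n) : v \in val f -> w \in val f -> val f = [set v; w].
        move=> vf wf; apply/esym/eqP; rewrite eqEcard cards2 eq_sym wv (eqP (valP f)) andbT.
        by apply/subsetP => u; rewrite !inE => /orP[] /eqP->.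
      have e'e : val e' = val e := etrans (pairE e' ve' we') (esym (pairE e ve we)).
      move/val_inj: e'e => <-.
      exact: xe'.
    have /set0Pn[w] : val e :\ v != set0.
      by rewrite -card_gt0; have := cardsD1 v (val e); rewrite ve (eqP (valP e)); case: #|_|.
    rewrite !inE => /andP[wv we]; exists w; rewrite // inE wv /=.
    by apply/existsP; exists e; rewrite xe ve.
  rewrite [X in _ || ~~ X && _](_ : _ = true) ?orbF; last first.
    by rewrite disjoint_sym disjoints1.
  have [xe|//] := boolP (x e); rewrite disjoint_subset; apply/subsetP => u ue.
  rewrite !inE negb_or negbK (VE e) // andbT.
  by apply: contraNneq ve => <-.
(* A permutation supported on [J] carries [A] to [B], giving isomorphic graphs. *)
have sym (A B : {set 'I_n}) : A \subset J -> B \subset J -> #|A| = #|B| ->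
    P (subst s A) = P (subst s B).
  move=> AJ BJ AB; have [t tJ tA] := perm_on_transitive _ _ _ AJ BJ AB.
  by rewrite -!sP // -tA -(Pinv t (attach _ _ _ (t @: A))) graph_perm_attach.
have diff u : u \in J -> P (subst s [set u]) != P (subst s set0).
  move=> uJ; rewrite (sym _ [set v]) ?sub1set ?cards1 // -!sP ?sub1set ?sub0set //.
  by rewrite xv x0.
have cJ : (n <= #|edges x|.*2 + #|J|)%N.
  apply: (@leq_trans (#|V| + #|~: V|)); first by rewrite cardsC card_ord.
  by rewrite leq_add ?card_cover_edges // subset_leq_card // subsetUr.
split; apply: leq_trans cJ _; rewrite leq_add2l.
  exact: (@subst_bs_ge _ _ P s J).
apply/ltnW/(@subst_deg_ge R _ _ P s J sym).
by exists [set v]; rewrite ?sub1set ?diff.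
Qed.

(** For [m] edges, [m <= bs P] and [n <= 2 * m + bs P] give [n <= 3 * bs P]; likewise
    [n <= 6 * deg R P]. No case split on [m] is needed. *)
Lemma graph_property_bounds (R : realType) n (P : boolfun (vpair n)) :
  graph_property P -> (exists x, P x != P [ffun=> false]) ->
  (n <= 4 * bs P)%N /\ (n <= 8 * deg R P)%N.
Proof.
move=> Pinv [x0 Px0].
have [x Px xmin] :=
  @arg_minnP _ x0 (fun y => P y != P [ffun=> false]) (fun y => #|edges y|) Px0.
have small y : (#|edges y| < #|edges x|)%N -> P y = P [ffun=> false].
  by rewrite ltnNge; apply: contraNeq => /xmin.
have [] := edges_bounds R n P x Px small.
have [] := isolated_bounds R n P x Pinv Px small.
by split; lia.
Qed.

(** * From the number of vertices to decision tree depth *)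

Lemma card_vpair n : #|vpair n| = 'C(n, 2).
Proof.
by rewrite card_sig -[n in RHS]card_ord -card_draws; apply: eq_card => e; rewrite !inE.
Qed.

Theorem theorem1 (R : realType) :
  exists c : R, 0 < c /\
    forall n : nat, (2 <= n)%N ->
    forall P : boolfun (vpair n), graph_property P ->
      (dt_complexity P)%:R <= c * (bs P)%:R ^+ 2 /\
      (dt_complexity P)%:R <= c * (deg R P)%:R ^+ 2.
Proof.
(* [32 = 8 ^ 2 / 2]: the depth is at most [n ^ 2 / 2], and the weaker bound is
   [n <= 8 * deg R P]. *)
exists 32; split=> // n _ P Pinv; rewrite -!natrX -!natrM !ler_nat.
have [nonconst|const] := pselect (exists x, P x != P [ffun=> false]); last first.
  suff : (dt_complexity P <= 0)%N by rewrite leqn0 => /eqP->.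
  apply: (@dt_complexity_le _ P (Leaf _ (P [ffun=> false]))) => x /=.
  by apply/eqP; rewrite eq_sym; apply/negPn/negP => Px; apply: const; exists x.
have [bsP degP] := graph_property_bounds R n P Pinv nonconst.
have Dn : (2 * dt_complexity P <= n ^ 2)%N.
  rewrite (leq_trans (leq_mul (leqnn 2) (dt_complexity_le_card _ P))) //.
  rewrite card_vpair bin2 mul2n; apply: (@leq_trans (n * n.-1)).
    by rewrite -[leqRHS]odd_double_half leq_addl.
  by rewrite -mulnn leq_mul // leq_pred.
have sq b k : (n <= k * b)%N -> (n ^ 2 <= k ^ 2 * b ^ 2)%N.
  by rewrite -expnMn leq_sqr.
have := sq _ _ bsP; have := sq _ _ degP.
by move: (bs P ^ 2)%N (deg R P ^ 2)%N Dn => b d Dn; split; lia.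
Qed.
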